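(* Let $\mathfrak{n}_4(\mathbb{R})$ be the real Lie algebra with basis $(e_1,e_2,e_3,e_4)$ and only non-trivial brackets $[e_1,e_2]=e_3$, $[e_1,e_3]=e_4$ (up to antisymmetry). The classification, up to isomorphism of algebras, of LR-algebra structures on $\mathfrak{n}_4(\mathbb{R})$ is given by the following list, i.e. every LR-algebra with associated Lie algebra isomorphic to $\mathfrak{n}_4(\mathbb{R})$ is isomorphic to exactly one of the following LR-algebras (products of basis vectors not listed are zero): (1) $A_1(\alpha)$, $\alpha\in\mathbb{R}$: $e_1\cdot e_1=\alpha(\alpha-1)e_2$, $e_1\cdot e_2=\alpha e_3$, $e_1\cdot e_3=\alpha e_4$, $e_2\cdot e_1=(\alpha-1)e_3$, $e_2\cdot e_2=e_4$, $e_3\cdot e_1=(\alpha-1)e_4$; (2) $A_2$: $e_1\cdot e_1=e_3$, $e_2\cdot e_1=-e_3$, $e_2\cdot e_2=e_4$, $e_3\cdot e_1=-e_4$; (3) $A_3$: $e_1\cdot e_1=e_3$, $e_1\cdot e_2=e_3$, $e_1\cdot e_3=e_4$, $e_2\cdot e_2=e_4$; (4) $A_4(\alpha,\beta,\gamma)$, $\alpha,\beta,\gamma\in\{0,1\}$: $e_1\cdot e_1=\alpha e_2$, $e_1\cdot e_2=\beta e_3+\gamma e_4$, $e_1\cdot e_3=\beta e_4$, $e_2\cdot e_1=(\beta-1)e_3+\gamma e_4$, $e_3\cdot e_1=(\beta-1)e_4$; (5) $A_5(\alpha)$, $\alpha\in\{0,1\}$: $e_1\cdot e_1=\alpha e_4$,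 $e_2\cdot e_1=-e_3$, $e_2\cdot e_2=e_3$, $e_2\cdot e_3=e_4$, $e_3\cdot e_1=-e_4$, $e_3\cdot e_2=e_4$; (6) $A_6$: $e_2\cdot e_1=-e_3$, $e_2\cdot e_2=e_2$, $e_2\cdot e_3=e_3$, $e_2\cdot e_4=e_4$, $e_3\cdot e_1=-e_4$, $e_3\cdot e_2=e_3$, $e_3\cdot e_3=e_4$, $e_4\cdot e_2=e_4$. The algebra $A_6$ is not complete. All the other ones are complete.
   Context: An LR-algebra over a field is an algebra $(A,\cdot)$ with bilinear product satisfying $x\cdot(y\cdot z)=y\cdot(x\cdot z)$ and $(x\cdot y)\cdot z=(x\cdot z)\cdot y$ for all $x,y,z\in A$. The commutator $[x,y]=x\cdot y-y\cdot x$ is then a Lie bracket, and $A$ with this bracket is the associated Lie algebra of $A$; an LR-algebra structure on a Lie algebra $\mathfrak{g}$ is an LR-algebra product on the vector space $\mathfrak{g}$ whose commutator is the given bracket. An LR-algebra is complete if all left multiplications $L(x)\colon y\mapsto x\cdot y$ are nilpotent. *)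

(* Defs.v *)
From HB Require Import structures.
From mathcomp Require Import all_boot all_order all_algebra ring.

Set Implicit Arguments.
Unset Strict Implicit.
Unset Printing Implicit Defensive.

Import GRing.Theory.
Local Open Scope ring_scope.

Section Algebras.
Variable F : fieldType.

(* Not necessarily associative, of arbitrary dimension. A Lie algebra is an
   algebra whose product, the bracket, satisfies [is_lie]; its isomorphisms
   are the isomorphisms of algebras. *)
Record algebra := MkAlgebra {
  carrier :> lmodType F;
  product : {bilinear carrier -> carrier -> carrier}
}.

Definition isomorphic (A B : algebra) : Prop :=
  exists f : {linear A -> B},
    bijective f /\ forall x y, f (product A x y) = product B (f x) (f y).

Definition is_lie (A : algebra) : Prop :=
  (forall x, product A x x = 0) /\
  (forall x y z, product A x (product A y z) + product A y (product A z x)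
                 + product A z (product A x y) = 0).

Definition is_LR (A : algebra) : Prop :=
  (forall x y z, product A x (product A y z) = product A y (product A x z)) /\
  (forall x y z, product A (product A x y) z = product A (product A x z) y).

Definition complete (A : algebra) : Prop :=
  forall x, exists n : nat, forall y, iter n (product A x) y = 0.

Definition commutator (A : algebra) (x y : A) : A :=
  product A x y - product A y x.

Lemma commutator_is_bilinear (A : algebra) :
  bilinear_for (GRing.Scale.Law.clone _ _ *:%R _)
    (GRing.Scale.Law.clone _ _ *:%R _) (@commutator A).
Proof.
split=> [u'|u] a x y /=; rewrite /commutator linearPl linearPr /= scalerBr;
  by rewrite opprD addrACA.
Qed.

HB.instance Definition _ (A : algebra) :=
  bilinear_isBilinear.Build F A A A _ _ (@commutator A)
    (commutator_is_bilinear A).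

Definition associated_lie (A : algebra) : algebra := MkAlgebra (@commutator A).

Lemma associated_lieP (A : algebra) : is_LR A -> is_lie (associated_lie A).
Proof.
case=> L R; split=> [x|x y z] /=; rewrite /commutator ?subrr //.
rewrite !linearBl !linearBr /= (L y x z) (L z x y) (L z y x).
rewrite (R y z x) (R z x y) (R z y x) (R x z y).
set a := product A x (product A y z); set b := product A x (product A z y).
set c := product A y (product A z x).
set d := product A (product A y x) z; set e := product A (product A z x) y.
set g := product A (product A x y) z.
rewrite -/a -/b -/c !opprB (addrACA (a - b)) [LHS]addrACA.
by rewrite [a - b + _]addrC [e - d + _]addrC !subrKA !subrr addr0.
Qed.

(* [is_LR_structure g m]: the product m on the vector space underlying the Lie
   algebra g is an LR-algebra structure on g. *)
Definition is_LR_structure (g : algebra) (m : {bilinear g -> g -> g}) : Prop :=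
  is_LR (MkAlgebra m) /\
  forall x y : g, commutator (A := MkAlgebra m) x y = product g x y.

(* The product on F^n with e_i . e_j = t i j; basis vectors are numbered from
   1, whereas 'I_n starts at 0. *)
Definition table_product (n : nat) (t : nat -> nat -> 'rV[F]_n)
    (x y : 'rV[F]_n) : 'rV[F]_n :=
  \sum_(i < n) \sum_(j < n) (x 0 i * y 0 j) *: t i.+1 j.+1.

Lemma table_product_is_bilinear n (t : nat -> nat -> 'rV[F]_n) :
  bilinear_for (GRing.Scale.Law.clone _ _ *:%R _)
    (GRing.Scale.Law.clone _ _ *:%R _) (table_product t).
Proof.
split=> [u'|u] a x y /=; rewrite /table_product scaler_sumr -big_split /=;
  apply: eq_bigr => i _; rewrite scaler_sumr -big_split /=;
  apply: eq_bigr => j _; rewrite !mxE scalerA -scalerDl.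
- by rewrite mulrDl mulrA.
- by rewrite mulrDr mulrCA.
Qed.

HB.instance Definition _ n (t : nat -> nat -> 'rV[F]_n) :=
  bilinear_isBilinear.Build F 'rV[F]_n 'rV[F]_n 'rV[F]_n _ _ (table_product t)
    (table_product_is_bilinear t).

Definition e (k : nat) : 'rV[F]_4 := \row_(j < 4) (j.+1 == k)%:R.

Lemma table_product_e (t : nat -> nat -> 'rV[F]_4) (i j : 'I_4) :
  table_product t (e i.+1) (e j.+1) = t i.+1 j.+1.
Proof.
rewrite /table_product (bigD1 i) //= (bigD1 j) //= !mxE !eqxx mulr1 scale1r.
rewrite !big1 ?addr0 // => k; rewrite -val_eqE => /negPf ki.
  by rewrite big1 // => m _; rewrite !mxE eqSS ki mul0r scale0r.
by rewrite !mxE eqSS ki mulr0 scale0r.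
Qed.

Definition n4_table (i j : nat) : 'rV[F]_4 :=
  match i, j with
  | 1, 2 => e 3 | 2, 1 => - e 3
  | 1, 3 => e 4 | 3, 1 => - e 4
  | _, _ => 0
  end.

Definition n4 : algebra := MkAlgebra (table_product n4_table).

Lemma n4_productE (x y : n4) :
  product n4 x y =
  (x 0 0 * y 0 1 - x 0 1 * y 0 0) *: e 3
  + (x 0 0 * y 0 2%:R - x 0 2%:R * y 0 0) *: e 4.
Proof.
rewrite /= /table_product !big_ord_recl !big_ord0 /=.
have E k : k = lift ord0 (lift ord0 ord0) :> 'I_4 -> k = 2%:R.
  by move=> ->; apply/val_inj.
have E1 : lift ord0 ord0 = 1 :> 'I_4 by apply/val_inj.
rewrite (E _ erefl) E1 !scaler0 !addr0 !add0r !scalerN !scalerBl.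
by rewrite addrACA.
Qed.

Lemma n4_lie : is_lie n4.
Proof.
split=> [x|x y z]; rewrite !n4_productE.
  by rewrite ![x 0 0 * _]mulrC !subrr !scale0r addr0.
by apply/rowP=> k; rewrite !mxE /=; ring.
Qed.

Definition A1_table (a : F) (i j : nat) : 'rV[F]_4 :=
  match i, j with
  | 1, 1 => (a * (a - 1)) *: e 2
  | 1, 2 => a *: e 3
  | 1, 3 => a *: e 4
  | 2, 1 => (a - 1) *: e 3
  | 2, 2 => e 4
  | 3, 1 => (a - 1) *: e 4
  | _, _ => 0
  end.

Definition A2_table (i j : nat) : 'rV[F]_4 :=
  match i, j with
  | 1, 1 => e 3
  | 2, 1 => - e 3
  | 2, 2 => e 4
  | 3, 1 => - e 4
  | _, _ => 0
  end.

Definition A3_table (i j : nat) : 'rV[F]_4 :=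
  match i, j with
  | 1, 1 => e 3
  | 1, 2 => e 3
  | 1, 3 => e 4
  | 2, 2 => e 4
  | _, _ => 0
  end.

Definition A4_table (a b c : F) (i j : nat) : 'rV[F]_4 :=
  match i, j with
  | 1, 1 => a *: e 2
  | 1, 2 => b *: e 3 + c *: e 4
  | 1, 3 => b *: e 4
  | 2, 1 => (b - 1) *: e 3 + c *: e 4
  | 3, 1 => (b - 1) *: e 4
  | _, _ => 0
  end.

Definition A5_table (a : F) (i j : nat) : 'rV[F]_4 :=
  match i, j with
  | 1, 1 => a *: e 4
  | 2, 1 => - e 3
  | 2, 2 => e 3
  | 2, 3 => e 4
  | 3, 1 => - e 4
  | 3, 2 => e 4
  | _, _ => 0
  end.

Definition A6_table (i j : nat) : 'rV[F]_4 :=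
  match i, j with
  | 2, 1 => - e 3
  | 2, 2 => e 2
  | 2, 3 => e 3
  | 2, 4 => e 4
  | 3, 1 => - e 4
  | 3, 2 => e 3
  | 3, 3 => e 4
  | 4, 2 => e 4
  | _, _ => 0
  end.

(* The members of the list, with their parameters; a parameter ranging over
   {0, 1} is a boolean, read in F through %:R. *)
Inductive label : Type :=
  | A1 of F
  | A2
  | A3
  | A4 of bool & bool & bool
  | A5 of bool
  | A6.

Definition label_table (l : label) : nat -> nat -> 'rV[F]_4 :=
  match l with
  | A1 a => A1_table a
  | A2 => A2_table
  | A3 => A3_table
  | A4 a b c => A4_table a%:R b%:R c%:R
  | A5 a => A5_table a%:R
  | A6 => A6_table
  end.

Definition listed_product (l : label) : {bilinear n4 -> n4 -> n4} :=
  table_product (label_table l).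

Definition listed (l : label) : algebra := MkAlgebra (listed_product l).

End Algebras.

(* Main.v *)
Require Import Defs.
From HB Require Import structures.
From mathcomp Require Import all_boot all_order all_algebra reals ring.

(** In an LR-algebra the left multiplications are commuting derivations of the
    associated Lie algebra ([LR_left_derivation]). On n4 this is very rigid.
    Write M for the abelian ideal spanned by e_2, e_3, e_4 and t for the action
    of ad e_1 on it, so that M is the free module of rank one generated by e_2
    over K = F[t]/(t^3), with e_3 = t e_2 and e_4 = t^2 e_2. Solving the linear
    conditions on derivations and on the commutator ([LR_on_n4_form]), and
    excluding an e_1-component of e_1 . e_1 by commutation ([form_LR_a0]),
    leaves

      e_1.e_1 = B e_2, e_1.e_2 = (C + t/2) e_2, e_2.e_1 = (C - t/2) e_2,
      e_2.e_2 = P e_2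

    with B, C, P in K, the product being K-linear in every argument from M. For
    such a product, both LR-identities amount to one equation in K, namely C^2 -
    B P = t^2 / 4 ([form_LRP]).

    An isomorphism between two such algebras is an automorphism of n4, so it
    sends e_1 to al e_1 + m e_2, e_2 to h e_2 and t to al t, with al a nonzero
    scalar, h a unit of K and m in K. It acts on (B, C, P), as on a binary
    quadratic form, by

      P' = h P,  C' = al C + m P,  h B' = al^2 B + 2 al m C + m^2 P

    where B', C', P' are evaluated at al t ([transport_isomorphic],
    [isomorphic_transport]). Classifying is thus finding the orbits, and these
    are sorted by the t-adic valuation of P. If P is a unit, make P = 1, then C
    = -t/2, and B is forced: this is A6. If the valuation is 1, make P = t and C
    = -t/2; then B is a multiple of t^2 which can be scaled to 0 or t^2: this is
    A5. If the valuation is 2, make P = t^2 and C = (d - 1/2) t, where d is an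
    invariant and B = d (d - 1) mod t; the coefficient of t^2 in B can be
    removed, and so can that of t unless d (d - 1) = 0, in which case it can be
    scaled to 0 or 1: these are A1, A2 and A3. If P = 0, then d is 0 or 1, the
    coefficient of t^2 in C can be scaled to 0 or 1, and B can be made 0 or 1:
    this is A4. The same invariants separate the algebras of the list
    ([transportable_inj]).

    For the algebras other than A6 one has P(0) = C(0) = 0, so that left
    multiplications map each term of the chain A > M > t M > t^2 M > 0 to the
    next one and are nilpotent; e_2 is a nonzero idempotent of A6. *)

Set Implicit Arguments.
Unset Strict Implicit.
Unset Printing Implicit Defensive.
Import GRing.Theory.
Local Open Scope ring_scope.

(** * Isomorphisms of algebras *)

Section Iso.
Variable F : fieldType.
Implicit Types A B C : algebra F.

Lemma isomorphic_sym A B : isomorphic A B -> isomorphic B A.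
Proof.
case=> f [[g fK gK] fM].
pose gl := GRing.isLinear.Build F B A *:%R g (can2_linear fK gK).
pose G : {linear B -> A} := HB.pack g gl.
exists G; split; first by exists f.
by move=> x y /=; apply: (can_inj fK); rewrite fM !gK.
Qed.

Lemma isomorphic_trans A B C :
  isomorphic A B -> isomorphic B C -> isomorphic A C.
Proof.
case=> f [fb fM] [g [gb gM]]; exists (g \o f).
by split; [exact: bij_comp | move=> x y /=; rewrite fM gM].
Qed.

Lemma isomorphic_eq (V : lmodType F) (m m' : {bilinear V -> V -> V}) :
  (forall x y, m x y = m' x y) -> isomorphic (MkAlgebra m) (MkAlgebra m').
Proof.
by move=> mE; exists idfun; split; [exists idfun | exact: mE].
Qed.

Lemma is_LR_isomorphic A B : isomorphic A B -> is_LR A -> is_LR B.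
Proof.
case=> f [[g _ gK] fM] [L R].
split=> x y z; rewrite -(gK x) -(gK y) -(gK z) -!fM; congr (f _);
  [exact: L | exact: R].
Qed.

(** The left identity exchanges x with y and z in the two terms of x . [y, z];
    what is left over cancels by the right identity. *)
Lemma LR_left_derivation A x y z : is_LR A ->
  product A x (commutator y z) =
  commutator (product A x y) z + commutator y (product A x z).
Proof.
case=> L R; rewrite /commutator linearBr /= L (L x z y) (R x z y).
by rewrite [RHS]addrC addrA subrK.
Qed.

Lemma commutator_morph A B (f : {linear A -> B}) :
  (forall x y, f (product A x y) = product B (f x) (f y)) ->
  forall x y, f (commutator x y) = commutator (f x) (f y).
Proof. by move=> fM x y; rewrite /commutator linearB !fM. Qed.

End Iso.

(** * Coordinates in dimension 4 *)

Section Coords.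
Variable F : fieldType.

Definition vec4 (a b c d : F) : 'rV[F]_4 := \row_(j < 4) [:: a; b; c; d]`_j.

Lemma vec4_ind (P : 'rV[F]_4 -> Prop) :
  (forall a b c d, P (vec4 a b c d)) -> forall x, P x.
Proof.
move=> H x; suff -> : x = vec4 (x 0 0) (x 0 1) (x 0 2%:R) (x 0 3%:R) by [].
by apply/rowP=> -[[|[|[|[|]]]] // i]; rewrite mxE /=; congr (x _ _);
  apply/val_inj.
Qed.

Lemma vec4_inj a b c d a' b' c' d' :
  vec4 a b c d = vec4 a' b' c' d' -> [/\ a = a', b = b', c = c' & d = d'].
Proof.
by move=> /rowP H; split; [move: (H 0) | move: (H 1) | move: (H 2%:R)
  | move: (H 3%:R)]; rewrite !mxE.
Qed.

Lemma vec4D a b c d a' b' c' d' :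
  vec4 a b c d + vec4 a' b' c' d' = vec4 (a + a') (b + b') (c + c') (d + d').
Proof. by apply/rowP=> -[[|[|[|[|]]]] // i]; rewrite !mxE. Qed.

Lemma vec4N a b c d : - vec4 a b c d = vec4 (- a) (- b) (- c) (- d).
Proof. by apply/rowP=> -[[|[|[|[|]]]] // i]; rewrite !mxE. Qed.

Lemma vec4Z k a b c d :
  k *: vec4 a b c d = vec4 (k * a) (k * b) (k * c) (k * d).
Proof. by apply/rowP=> -[[|[|[|[|]]]] // i]; rewrite !mxE. Qed.

Lemma vec4_0 : 0 = vec4 0 0 0 0.
Proof. by apply/rowP=> -[[|[|[|[|]]]] // i]; rewrite !mxE. Qed.

Lemma e1E : e F 1 = vec4 1 0 0 0.
Proof. by apply/rowP=> -[[|[|[|[|]]]] // i]; rewrite !mxE. Qed.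
Lemma e2E : e F 2 = vec4 0 1 0 0.
Proof. by apply/rowP=> -[[|[|[|[|]]]] // i]; rewrite !mxE. Qed.
Lemma e3E : e F 3 = vec4 0 0 1 0.
Proof. by apply/rowP=> -[[|[|[|[|]]]] // i]; rewrite !mxE. Qed.
Lemma e4E : e F 4 = vec4 0 0 0 1.
Proof. by apply/rowP=> -[[|[|[|[|]]]] // i]; rewrite !mxE. Qed.

Definition vec4E := (e1E, e2E, e3E, e4E, vec4_0, vec4Z, vec4N, vec4D).

Lemma table_productE (t : nat -> nat -> 'rV[F]_4) x0 x1 x2 x3 y0 y1 y2 y3 :
  table_product t (vec4 x0 x1 x2 x3) (vec4 y0 y1 y2 y3) =
    (x0 * y0) *: t 1 1 + (x0 * y1) *: t 1 2 + (x0 * y2) *: t 1 3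
    + (x0 * y3) *: t 1 4
    + ((x1 * y0) *: t 2 1 + (x1 * y1) *: t 2 2 + (x1 * y2) *: t 2 3
    + (x1 * y3) *: t 2 4)
    + ((x2 * y0) *: t 3 1 + (x2 * y1) *: t 3 2 + (x2 * y2) *: t 3 3
    + (x2 * y3) *: t 3 4)
    + ((x3 * y0) *: t 4 1 + (x3 * y1) *: t 4 2 + (x3 * y2) *: t 4 3
    + (x3 * y3) *: t 4 4).
Proof.
by rewrite /table_product !big_ord_recl !big_ord0 !mxE /= !addr0 !addrA.
Qed.

Lemma n4_product_vec4 x0 x1 x2 x3 y0 y1 y2 y3 :
  product (n4 F) (vec4 x0 x1 x2 x3) (vec4 y0 y1 y2 y3) =
  vec4 0 0 (x0 * y1 - x1 * y0) (x0 * y2 - x2 * y0).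
Proof.
rewrite /= table_productE /= !vec4E.
by congr vec4; ring.
Qed.

(** Row vectors are acted upon from the right, so the rows are the images of the
    basis vectors. *)
Definition row_map (v1 v2 v3 v4 : 'rV[F]_4) : 'M[F]_4 :=
  \matrix_(i < 4) [:: v1; v2; v3; v4]`_i.

Lemma row_mapE v1 v2 v3 v4 x0 x1 x2 x3 :
  vec4 x0 x1 x2 x3 *m row_map v1 v2 v3 v4 =
  x0 *: v1 + x1 *: v2 + x2 *: v3 + x3 *: v4.
Proof.
rewrite mulmx_sum_row !big_ord_recl big_ord0 !rowK !mxE /= addr0.
by rewrite !addrA.
Qed.

(** Structure constants transported along g and f: this replaces an abstract
    algebra by a multiplication table on row vectors. *)
Lemma table_product_basis (A : algebra F) (g : {linear 'rV[F]_4 -> A})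
    (f : {linear A -> 'rV[F]_4}) x y :
  f (product A (g x) (g y)) =
  table_product (fun i j => f (product A (g (e F i)) (g (e F j)))) x y.
Proof.
have eE (z : 'rV[F]_4) : z = \sum_(i < 4) z 0 i *: e F i.+1.
  rewrite [LHS]row_sum_delta; apply: eq_bigr => i _; congr (_ *: _).
  by apply/rowP=> j; rewrite !mxE.
rewrite {1}(eE x) {1}(eE y) (linear_sum g) linear_sumlz linear_sum.
apply: eq_bigr => i _; rewrite (linear_sum g) linear_sumr linear_sum.
apply: eq_bigr => j _; rewrite !(linearZ_LR g) linearZl_LR linearZr_LR /=.
by rewrite !(linearZ_LR f) scalerA.
Qed.

End Coords.

(** * Products on n4 whose left multiplications are derivations *)

Section Forms.
Variable F : fieldType.

(** The coefficients of B = B0 + B1 t + B2 t^2, C + t/2 = C0 + C1 t + C2 t^2 and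
    P = P0 + P1 t + P2 t^2. Recording C + t/2 rather than C avoids dividing by
    2. *)
Record qform := Form {
  B0 : F; B1 : F; B2 : F; C0 : F; C1 : F; C2 : F; P0 : F; P1 : F; P2 : F
}.

(** The scalar a is the e_1-component of e_1 . e_1; it is kept as long as only
    the derivation property has been used; the LR-identities force 2 a^2 = 0. *)
Definition form_table (a : F) (k : qform) (i j : nat) : 'rV[F]_4 :=
  match i, j with
  | 1, 1 => vec4 a (B0 k) (B1 k) (B2 k)
  | 1, 2 => vec4 0 (C0 k) (C1 k) (C2 k)
  | 2, 1 => vec4 0 (C0 k) (C1 k - 1) (C2 k)
  | 1, 3 => vec4 0 0 (a + C0 k) (C1 k)
  | 3, 1 => vec4 0 0 (a + C0 k) (C1 k - 1)
  | 1, 4 | 4, 1 => vec4 0 0 0 (a *+ 2 + C0 k)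
  | 2, 2 => vec4 0 (P0 k) (P1 k) (P2 k)
  | 2, 3 | 3, 2 => vec4 0 0 (P0 k) (P1 k)
  | 2, 4 | 3, 3 | 4, 2 => vec4 0 0 0 (P0 k)
  | _, _ => 0
  end.

Definition form_algebra a k : algebra F :=
  MkAlgebra (table_product (form_table a k)).

(** The coefficients of C^2 - t^2/4 - B P in F[t]/(t^3). *)
Definition defect0 k := C0 k ^+ 2 - B0 k * P0 k.
Definition defect1 k :=
  (C1 k *+ 2 - 1) * C0 k - B0 k * P1 k - B1 k * P0 k.
Definition defect2 k :=
  C0 k * C2 k *+ 2 + C1 k * (C1 k - 1)
  - B0 k * P2 k - B1 k * P1 k - B2 k * P0 k.

Definition LR_relations k : Prop :=
  [/\ defect0 k = 0, defect1 k = 0 & defect2 k = 0].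

Lemma form_productE a k x0 x1 x2 x3 y0 y1 y2 y3 :
  table_product (form_table a k) (vec4 x0 x1 x2 x3) (vec4 y0 y1 y2 y3) =
  vec4 (a * (x0 * y0))
    (B0 k * (x0 * y0) + C0 k * (x0 * y1 + x1 * y0) + P0 k * (x1 * y1))
    (B1 k * (x0 * y0) + C1 k * (x0 * y1 + x1 * y0) - x1 * y0
     + (a + C0 k) * (x0 * y2 + x2 * y0)
     + P1 k * (x1 * y1) + P0 k * (x1 * y2 + x2 * y1))
    (B2 k * (x0 * y0) + C2 k * (x0 * y1 + x1 * y0)
     + C1 k * (x0 * y2 + x2 * y0) - x2 * y0
     + (a *+ 2 + C0 k) * (x0 * y3 + x3 * y0)
     + P2 k * (x1 * y1) + P1 k * (x1 * y2 + x2 * y1)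
     + P0 k * (x1 * y3 + x2 * y2 + x3 * y1)).
Proof. by rewrite table_productE /= !vec4E; congr vec4; ring. Qed.

Lemma form_commutator k x y :
  commutator (x : form_algebra 0 k) y = product (n4 F) x y.
Proof.
elim/vec4_ind: x => x0 x1 x2 x3; elim/vec4_ind: y => y0 y1 y2 y3.
rewrite n4_product_vec4 /commutator /= !form_productE !vec4E.
by congr vec4; ring.
Qed.

(** Write x = x_0 e_1 + g e_2, y = y_0 e_1 + h e_2 and z = z_0 e_1 + w e_2 with
    g, h, w in K = F[t]/(t^3). Expanding, x . (y . z) - y . (x . z) equals
    z_0 (C^2 - t^2/4 - B P) (x_0 h - y_0 g) e_2. *)
Lemma form_left_defect k x0 x1 x2 x3 y0 y1 y2 y3 z0 z1 z2 z3 :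
  let mul := product (form_algebra 0 k) in
  let x := vec4 x0 x1 x2 x3 in let y := vec4 y0 y1 y2 y3 in
  let z := vec4 z0 z1 z2 z3 in
  let w1 := x0 * y1 - y0 * x1 in let w2 := x0 * y2 - y0 * x2 in
  let w3 := x0 * y3 - y0 * x3 in
  mul x (mul y z) - mul y (mul x z) =
  vec4 0 (z0 * (defect0 k * w1)) (z0 * (defect0 k * w2 + defect1 k * w1))
    (z0 * (defect0 k * w3 + defect1 k * w2 + defect2 k * w1)).
Proof.
rewrite /= !form_productE !vec4E /defect0 /defect1 /defect2.
by congr vec4; ring.
Qed.

(** The same computation for the right identity, with the roles of x and z
    exchanged: the right multiplications carry C - t/2 in place of C + t/2, and
    only the product of these two enters. *)
Lemma form_right_defect k x0 x1 x2 x3 y0 y1 y2 y3 z0 z1 z2 z3 :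
  let mul := product (form_algebra 0 k) in
  let x := vec4 x0 x1 x2 x3 in let y := vec4 y0 y1 y2 y3 in
  let z := vec4 z0 z1 z2 z3 in
  let w1 := z0 * y1 - y0 * z1 in let w2 := z0 * y2 - y0 * z2 in
  let w3 := z0 * y3 - y0 * z3 in
  mul (mul x y) z - mul (mul x z) y =
  vec4 0 (x0 * (defect0 k * w1)) (x0 * (defect0 k * w2 + defect1 k * w1))
    (x0 * (defect0 k * w3 + defect1 k * w2 + defect2 k * w1)).
Proof.
rewrite /= !form_productE !vec4E /defect0 /defect1 /defect2.
by congr vec4; ring.
Qed.

Lemma form_LRP k :
  is_LR (form_algebra 0 k) <-> LR_relations k.
Proof.
split=> [[L _]|[d0 d1 d2]].
  have := form_left_defect k 1 0 0 0 0 1 0 0 1 0 0 0.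
  rewrite /= L subrr !vec4E => /vec4_inj[_].
  by rewrite !(mulr0, mul0r, mulr1, mul1r, subr0, add0r, addr0) => *; split.
split=> x y z; elim/vec4_ind: x => x0 x1 x2 x3;
  elim/vec4_ind: y => y0 y1 y2 y3; elim/vec4_ind: z => z0 z1 z2 z3;
  apply: subr0_eq; rewrite (form_left_defect, form_right_defect) d0 d1 d2.
  by rewrite !(mul0r, mulr0, addr0) -vec4_0.
by rewrite !(mul0r, mulr0, addr0) -vec4_0.
Qed.

(** Left multiplication by e_1 commutes with those by e_2, e_3 and e_4; the
    values at e_1 show that X^2 - a X takes one and the same value at the three
    terms C0, a + C0 and 2a + C0 of an arithmetic progression, so that its
    second difference, which is 2a^2, vanishes. *)
Lemma form_LR_a0 a k : 2 != 0 :> F -> is_LR (form_algebra a k) -> a = 0.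
Proof.
move=> nz2 [L _].
move: (L (e F 1) (e F 2) (e F 1)) (L (e F 1) (e F 3) (e F 1))
  (L (e F 1) (e F 4) (e F 1)).
rewrite /= !vec4E !form_productE.
rewrite !(mulr0, mul0r, mulr1, mul1r, subr0, sub0r, add0r, addr0).
move=> /vec4_inj[_ E2 _ _] /vec4_inj[_ _ E3 _] /vec4_inj[_ _ _ E4].
have : (a ^+ 2) *+ 2 = 0.
  rewrite [LHS](_ : _ = (a *+ 2 + C0 k) * (a *+ 2 + C0 k)
    - ((a + C0 k) * (a + C0 k)) *+ 2 + C0 k * C0 k); last by ring.
  by rewrite E2 E3 E4; ring.
by move/eqP; rewrite -mulr_natr mulf_eq0 (negPf nz2) orbF expf_eq0 => /eqP.
Qed.

(** A derivation is determined by its values at the generators e_1 and e_2; the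
    relation [e_2, e_3] = 0 forbids an e_1-component at e_2. *)
Lemma derivation_n4 (D : {linear 'rV[F]_4 -> 'rV[F]_4}) :
  (forall x y : n4 F, D (product (n4 F) x y) =
     product (n4 F) (D x) y + product (n4 F) x (D y)) ->
  exists a b u v c d f, [/\ D (e F 1) = vec4 a b u v,
    D (e F 2) = vec4 0 c d f, D (e F 3) = vec4 0 0 (a + c) d
    & D (e F 4) = vec4 0 0 0 (a *+ 2 + c)].
Proof.
move=> DM.
have E3 : e F 3 = product (n4 F) (e F 1) (e F 2).
  by rewrite !vec4E n4_product_vec4; congr vec4; ring.
have E4 : e F 4 = product (n4 F) (e F 1) (e F 3).
  by rewrite !vec4E n4_product_vec4; congr vec4; ring.
have E0 : 0 = product (n4 F) (e F 2) (e F 3).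
  by rewrite !vec4E n4_product_vec4; congr vec4; ring.
move: (DM (e F 1) (e F 2)) (DM (e F 1) (e F 3)) (DM (e F 2) (e F 3)).
rewrite -E3 -E4 -E0 linear0.
elim/vec4_ind: (D (e F 1)) => a b u v; elim/vec4_ind: (D (e F 2)) => s c d f.
move=> ->; rewrite !vec4E !n4_product_vec4 !vec4E n4_product_vec4 => ->.
rewrite !n4_product_vec4 !vec4E => /vec4_inj[_ _ _ /eqP].
rewrite !(mulr0, mul0r, mulr1, mul1r, subr0, sub0r, add0r, addr0) => /eqP s0.
have {}s0 : s = 0 by rewrite s0.
by exists a, b, u, v, c, d, f; rewrite s0; split=> //; congr vec4; ring.
Qed.

(** Each of the four left multiplications by basis vectors is a derivation,
    hence given by seven scalars; e_j . e_i = e_i . e_j - [e_i, e_j] then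
    expresses everything through e_1 . e_1, e_1 . e_2 and e_2 . e_2. *)
Lemma LR_on_n4_form (m : {bilinear 'rV[F]_4 -> 'rV[F]_4 -> 'rV[F]_4}) :
  is_LR (MkAlgebra m) ->
  (forall x y, m x y - m y x = product (n4 F) x y) ->
  exists a k, forall x y, m x y = table_product (form_table a k) x y.
Proof.
move=> mLR mC.
have Lder z : exists a b u v c d f, [/\ m z (e F 1) = vec4 a b u v,
    m z (e F 2) = vec4 0 c d f, m z (e F 3) = vec4 0 0 (a + c) d
    & m z (e F 4) = vec4 0 0 0 (a *+ 2 + c)].
  apply: (derivation_n4 (D := m z)) => x y.
  have := LR_left_derivation (z : MkAlgebra m) x y mLR.
  by rewrite /commutator /= !mC.
have [a [b [u [v [c [d [f [m11 m12 m13 m14]]]]]]]] := Lder (e F 1).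
have [a2 [b2 [u2 [v2 [p [q [r [m21 m22 m23 m24]]]]]]]] := Lder (e F 2).
have [a3 [b3 [u3 [v3 [c3 [d3 [f3 [m31 m32 m33 m34]]]]]]]] := Lder (e F 3).
have [a4 [b4 [u4 [v4 [c4 [d4 [f4 [m41 m42 m43 m44]]]]]]]] := Lder (e F 4).
have swap x y : m y x = m x y - product (n4 F) x y by rewrite -mC subKr.
have /vec4_inj[? ? ? ?] : vec4 a2 b2 u2 v2 = vec4 0 c (d - 1) f.
  rewrite -m21 swap m12 !vec4E n4_product_vec4 !vec4E.
  by congr vec4; ring.
have /vec4_inj[? ? ? ?] : vec4 a3 b3 u3 v3 = vec4 0 0 (a + c) (d - 1).
  rewrite -m31 swap m13 !vec4E n4_product_vec4 !vec4E.
  by congr vec4; ring.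
have /vec4_inj[? ? ? ?] : vec4 a4 b4 u4 v4 = vec4 0 0 0 (a *+ 2 + c).
  rewrite -m41 swap m14 !vec4E n4_product_vec4 !vec4E.
  by congr vec4; ring.
subst.
have /vec4_inj[_ ? ? ?] : vec4 0 c3 d3 f3 = vec4 0 0 p q.
  rewrite -m32 swap m23 !vec4E n4_product_vec4 !vec4E.
  by congr vec4; ring.
have /vec4_inj[_ ? ? ?] : vec4 0 c4 d4 f4 = vec4 0 0 0 p.
  rewrite -m42 swap m24 !vec4E n4_product_vec4 !vec4E.
  by congr vec4; ring.
subst; exists a, (Form b u v c d f p q r) => x y.
have /= -> := @table_product_basis F (MkAlgebra m) idfun idfun x y.
elim/vec4_ind: x => x0 x1 x2 x3; elim/vec4_ind: y => y0 y1 y2 y3.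
rewrite form_productE table_productE m11 m12 m13 m14 m21 m22 m23 m24.
rewrite m31 m32 m33 m34 m41 m42 m43 m44 !vec4E /=.
by congr vec4; ring.
Qed.

End Forms.

(** * Isomorphisms as changes of parameters *)

Section Transport.
Variable F : fieldType.
Implicit Types k : qform F.

(** Coefficients of 1, t and t^2 in the identities P' = h P, C' = al C + m P and
    h B' = al^2 B + 2 al m C + m^2 P, where h = h0 + h1 t + h2 t^2,
    m = m0 + m1 t + m2 t^2 and the primed series are evaluated at al t. As C1 is
    the coefficient of C + t/2, the coefficient of t in 2 C is 2 C1 - 1. *)
Definition transport_relations (al h0 h1 h2 m0 m1 m2 : F) k' k : Prop :=
  [/\ [/\ P0 k' = h0 * P0 k,
          al * P1 k' = h0 * P1 k + h1 * P0 k
        & al ^+ 2 * P2 k' = h0 * P2 k + h1 * P1 k + h2 * P0 k],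
      [/\ C0 k' = al * C0 k + m0 * P0 k,
          al * C1 k' = al * C1 k + m0 * P1 k + m1 * P0 k
        & al ^+ 2 * C2 k' = al * C2 k + m0 * P2 k + m1 * P1 k + m2 * P0 k]
    & [/\ h0 * B0 k' = al ^+ 2 * B0 k + al * m0 * C0 k *+ 2 + m0 ^+ 2 * P0 k,
          h0 * (al * B1 k') + h1 * B0 k' =
            al ^+ 2 * B1 k + al * (m0 * (C1 k *+ 2 - 1) + m1 * C0 k *+ 2)
            + (m0 ^+ 2 * P1 k + m0 * m1 * P0 k *+ 2)
        & h0 * (al ^+ 2 * B2 k') + h1 * (al * B1 k') + h2 * B0 k' =
            al ^+ 2 * B2 k
            + al * (m0 * C2 k *+ 2 + m1 * (C1 k *+ 2 - 1) + m2 * C0 k *+ 2)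
            + (m0 ^+ 2 * P2 k + m0 * m1 * P1 k *+ 2
               + (m1 ^+ 2 + m0 * m2 *+ 2) * P0 k)]].

Definition transportable k' k : Prop :=
  exists al h0 h1 h2 m0 m1 m2 : F, [/\ al != 0, h0 != 0
    & transport_relations al h0 h1 h2 m0 m1 m2 k' k].

Lemma row_map_unit (a0 a1 a2 a3 b1 b2 b3 c2 c3 d3 : F) :
  a0 * b1 * c2 * d3 != 0 ->
  row_map (vec4 a0 a1 a2 a3) (vec4 0 b1 b2 b3) (vec4 0 0 c2 c3) (vec4 0 0 0 d3)
    \in unitmx.
Proof.
move=> nz; rewrite unitmxE -det_tr det_trig; last first.
  by apply/is_trig_mxP=> -[[|[|[|[|]]]] // i] [[|[|[|[|]]]] // j] //;
    rewrite !mxE /= ?mxE.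
by rewrite !big_ord_recl big_ord0 !mxE /= ?mxE /= mulr1 !mulrA unitfE.
Qed.

(** The map sending e_1 to al e_1 + m e_2 and e_2 to h e_2. Its values at
    e_3 = [e_1, e_2] and e_4 = [e_1, e_3] are then al t h e_2 and
    al^2 t^2 h e_2. *)
Lemma transport_isomorphic k' k : transportable k' k ->
  isomorphic (form_algebra 0 k') (form_algebra 0 k).
Proof.
case=> al [h0 [h1 [h2 [m0 [m1 [m2 [al0 h00]]]]]]].
(* The relations are solved for the primed coefficients. *)
case: k' => b' u' v' c' d' f' p' q' r'; case: k => b u v c d f p q r.
case=> /= -[-> /(canRL (mulKf al0)) -> /(canRL (mulKf (expf_neq0 2 al0))) ->].
case=> -> /(canRL (mulKf al0)) -> /(canRL (mulKf (expf_neq0 2 al0))) ->.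
case=> /(canRL (mulKf h00)) -> /(canRL (addrK _)) /(canRL (mulKf h00)).
move=> /(canRL (mulKf al0)) ->.
rewrite -[in X in X -> _]addrA => /(canRL (addrK _)) /(canRL (mulKf h00)).
move=> /(canRL (mulKf (expf_neq0 2 al0))) ->.
pose M := row_map (vec4 al m0 m1 m2) (vec4 0 h0 h1 h2)
  (vec4 0 0 (al * h0) (al * h1)) (vec4 0 0 0 (al ^+ 2 * h0)).
have MU : M \in unitmx.
  by apply: row_map_unit; rewrite !mulf_neq0 // expf_neq0.
exists (mulmxr M : {linear 'rV[F]_4 -> 'rV[F]_4}); split.
  by exists (mulmxr (invmx M)) => x /=; rewrite (mulmxK, mulmxKV).
move=> x y; elim/vec4_ind: x => x0 x1 x2 x3; elim/vec4_ind: y => y0 y1 y2 y3.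
rewrite /= form_productE /= !row_mapE !vec4E form_productE /=.
by congr vec4; field; rewrite ?al0 ?h00.
Qed.

(** Makes an identity modulo given equations provable by normalisation: the
    coefficients c1 and c2 exhibit it as a linear combination of them. *)
Lemma eq_comb (x y x1 y1 x2 y2 z w c1 c2 : F) :
  x = y -> x1 = y1 -> x2 = y2 ->
  z - w = (x - y) + c1 * (x1 - y1) + c2 * (x2 - y2) -> z = w.
Proof.
by move=> -> -> -> E; apply: subr0_eq; rewrite E !subrr !mulr0 !addr0.
Qed.

(** An isomorphism f preserves commutators, hence is an automorphism of n4: it
    is determined by f(e_1) and f(e_2), and since [f(e_2), f(e_3)] = 0 while
    f(e_4) != 0, the e_1-component s of f(e_2) is zero. The relations are the
    coordinates of f(e_i . e_j) = f(e_i) . f(e_j) for i, j in {1, 2}, divided by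
    h when one of i, j is 2. *)
Lemma isomorphic_transport k' k :
  isomorphic (form_algebra 0 k') (form_algebra 0 k) ->
  transportable k' k.
Proof.
case=> f [fb fM].
have fC (x y : n4 F) : f (product (n4 F) x y) = product (n4 F) (f x) (f y).
  rewrite -(form_commutator (k := k') x y).
  rewrite -(form_commutator (k := k) (f x) (f y)).
  exact: (commutator_morph fM).
have f0 x : f x = 0 -> x = 0.
  by move=> fx0; apply: (bij_inj fb); rewrite fx0 linear0.
have f3 : f (e F 3) = product (n4 F) (f (e F 1)) (f (e F 2)).
  by rewrite -fC !vec4E n4_product_vec4; congr (f (vec4 _ _ _ _)); ring.
have f4 : f (e F 4) = product (n4 F) (f (e F 1)) (f (e F 3)).
  by rewrite -fC !vec4E n4_product_vec4; congr (f (vec4 _ _ _ _)); ring.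
have f23 : product (n4 F) (f (e F 2)) (f (e F 3)) = 0.
  rewrite -fC; transitivity (f 0); last exact: linear0.
  by rewrite !vec4E n4_product_vec4; congr (f (vec4 _ _ _ _)); ring.
have f4n0 : f (e F 4) <> 0.
  by move=> /f0; rewrite !vec4E => /vec4_inj[_ _ _ /eqP]; rewrite oner_eq0.
have F11 := fM (e F 1) (e F 1); have F12 := fM (e F 1) (e F 2).
have F22 := fM (e F 2) (e F 2).
move: f3 f4 f23 f4n0 F11 F12 F22.
have fE x0 x1 x2 x3 : f (vec4 x0 x1 x2 x3) = x0 *: f (e F 1) + x1 *: f (e F 2)
    + x2 *: f (e F 3) + x3 *: f (e F 4).
  rewrite -!linearZ -!linearD !vec4E.
  by congr (f (vec4 _ _ _ _)); ring.
elim/vec4_ind: (f (e F 1)) fE => al m0 m1 m2.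
elim/vec4_ind: (f (e F 2)) => s h0 h1 h2 fE.
rewrite n4_product_vec4 => f3; rewrite f3 n4_product_vec4 => f4.
rewrite f4 n4_product_vec4 !vec4E.
rewrite !(mulr0, subr0) => /vec4_inj[_ _ _ /eqP] + nz.
have /norP[al0 d0] : ~~ ((al == 0) || (al * h0 - m0 * s == 0)).
  by rewrite -mulf_eq0; apply/eqP => E; apply: nz; rewrite E.
rewrite mulf_eq0 (negPf d0) orbF => /eqP s0.
subst s; move: d0; rewrite mulr0 subr0 mulf_eq0 (negPf al0) /= => h00.
rewrite /= !form_productE !fE f3 f4 !vec4E.
case/vec4_inj=> _ B0E B1E B2E; case/vec4_inj=> _ C0E C1E C2E.
case/vec4_inj=> _ P0E P1E P2E.
(* Division by h = h0 + h1 t + h2 t^2 is triangular: the lower coefficients are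
   subtracted, multiplied by h1 and h2, before cancelling h0. *)
have {}P0E : P0 k' = h0 * P0 k.
  apply: (mulfI h00).
  by apply: (eq_comb (c1 := 0) (c2 := 0) P0E (erefl 0) (erefl 0)); ring.
have {}P1E : al * P1 k' = h0 * P1 k + h1 * P0 k.
  apply: (mulfI h00).
  by apply: (eq_comb (c1 := - h1) (c2 := 0) P1E P0E (erefl 0)); ring.
have {}P2E : al ^+ 2 * P2 k' = h0 * P2 k + h1 * P1 k + h2 * P0 k.
  apply: (mulfI h00).
  by apply: (eq_comb (c1 := - h1) (c2 := - h2) P2E P1E P0E); ring.
have {}C0E : C0 k' = al * C0 k + m0 * P0 k.
  apply: (mulfI h00).
  by apply: (eq_comb (c1 := 0) (c2 := 0) C0E (erefl 0) (erefl 0)); ring.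
have {}C1E : al * C1 k' = al * C1 k + m0 * P1 k + m1 * P0 k.
  apply: (mulfI h00).
  by apply: (eq_comb (c1 := - h1) (c2 := 0) C1E C0E (erefl 0)); ring.
have {}C2E : al ^+ 2 * C2 k' = al * C2 k + m0 * P2 k + m1 * P1 k + m2 * P0 k.
  apply: (mulfI h00).
  by apply: (eq_comb (c1 := - h1) (c2 := - h2) C2E C1E C0E); ring.
exists al, h0, h1, h2, m0, m1, m2; split=> //; split; split=> //.
- by apply: (eq_comb (c1 := 0) (c2 := 0) B0E (erefl 0) (erefl 0)); ring.
- by apply: (eq_comb (c1 := 0) (c2 := 0) B1E (erefl 0) (erefl 0)); ring.
- by apply: (eq_comb (c1 := 0) (c2 := 0) B2E (erefl 0) (erefl 0)); ring.
Qed.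

End Transport.

(** * Normal forms *)

Section Classification.
Variable F : fieldType.
Implicit Types (k : qform F) (l : label F).

Definition form_of l : qform F :=
  match l with
  | A1 a => Form (a * (a - 1)) 0 0 0 a 0 0 0 1
  | A2 => Form 0 1 0 0 0 0 0 0 1
  | A3 => Form 0 1 0 0 1 0 0 0 1
  | A4 a b c => Form a%:R 0 0 0 b%:R c%:R 0 0 0
  | A5 a => Form 0 0 a%:R 0 0 0 0 1 0
  | A6 => Form 0 0 0 0 0 0 1 0 0
  end.

Lemma listed_formE l x y :
  listed_product l x y = table_product (form_table 0 (form_of l)) x y.
Proof.
elim/vec4_ind: x => x0 x1 x2 x3; elim/vec4_ind: y => y0 y1 y2 y3.
by case: l => [a|||a b c|a|]; rewrite form_productE /listed_product /=;
  rewrite table_productE /= !vec4E; congr vec4; ring.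
Qed.

Lemma form_of_LR l : is_LR (form_algebra 0 (form_of l)).
Proof.
apply/form_LRP; rewrite /LR_relations /defect0 /defect1 /defect2.
by case: l => [a|||a [] c|a|]; split=> /=; ring.
Qed.

(** P is a unit: h = 1 / P makes P' = 1 and m = - (C + t/2) / P makes
    C' = - t/2; the LR-relation then determines B' = C'^2 - t^2/4 = 0. *)
Lemma transport_to_A6 k :
  LR_relations k ->
  P0 k != 0 -> transportable (form_of (A6 F)) k.
Proof.
rewrite /LR_relations /defect0 /defect1 /defect2.
case: k => b u v c d f p q r /=.
case=> D0 D1 D2 p0.
have bE : b = c ^+ 2 / p.
  apply: (canRL (mulfK p0)).
  by apply: (eq_comb (c1 := -1) (c2 := 0) (erefl 0) D0 (erefl 0)); ring.
have uE : u = ((d *+ 2 - 1) * c - b * q) / p.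
  apply: (canRL (mulfK p0)).
  by apply: (eq_comb (c1 := -1) (c2 := 0) (erefl 0) D1 (erefl 0)); ring.
have vE : v = (c * f *+ 2 + d * (d - 1) - b * r - u * q) / p.
  apply: (canRL (mulfK p0)).
  by apply: (eq_comb (c1 := -1) (c2 := 0) (erefl 0) D2 (erefl 0)); ring.
pose h0 := p^-1; pose h1 := - (h0 * q) / p.
pose m0 := - c / p; pose m1 := - (d + m0 * q) / p.
exists 1, h0, h1, (- (h0 * r + h1 * q) / p).
exists m0, m1, (- (f + m0 * r + m1 * q) / p).
split; rewrite ?oner_neq0 ?invr_neq0 //.
rewrite vE uE bE /m1 /m0 /h1 /h0.
by split; split=> /=; field.
Qed.

(** P = q t + r t^2 with q != 0: h = al t / P and a suitable m make P' = t and
    C' = - t/2, leaving B' = (w / h0) t^2 with w independent of al and h; the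
    relation al = h0 q keeps h0 free, and h0 = w normalises w to 1. *)
Lemma transport_to_A5 k :
  LR_relations k ->
  P0 k = 0 -> P1 k != 0 -> exists a, transportable (form_of (A5 F a)) k.
Proof.
rewrite /LR_relations /defect0 /defect1 /defect2.
case: k => b u v c d f p q r /=.
case=> D0 D1 D2 p0 q0; move: D0 D1 D2; rewrite {}p0 !mulr0 !subr0.
move=> /eqP; rewrite expf_eq0 => /eqP ->; rewrite !mulr0 !mul0r sub0r.
move=> /eqP; rewrite oppr_eq0 mulf_eq0 (negPf q0) orbF => /eqP ->.
rewrite mul0r mul0rn add0r subr0 => /subr0_eq D2.
have uE : u = d * (d - 1) / q by apply: (canRL (mulfK q0)).
pose m0 := - d / q; pose m1 := - (f + m0 * r) / q.
pose w := v + m0 * f *+ 2 + m1 * (d *+ 2 - 1) + m0 ^+ 2 * r + m0 * m1 * q *+ 2.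
pose h0 := if w == 0 then 1 else w.
have h00 : h0 != 0 by rewrite /h0; case: ifPn => // _; rewrite oner_eq0.
have wE : h0 * (w != 0)%:R = w.
  by rewrite /h0; case: eqVneq => [->|_]; rewrite (mulr0, mulr1).
exists (w != 0), (h0 * q), h0, (- h0 * r / q), 0.
exists (h0 * q * m0), (h0 * q * m1), 0; split; rewrite ?mulf_neq0 //.
split; split=> /=; try by rewrite ?uE /m1 /m0; field.
apply: (eq_comb (c1 := (h0 * q) ^+ 2) (c2 := 0) (erefl 0) wE (erefl 0)).
move: (_%:R) => V; clearbody h0.
by rewrite /w /m1 /m0; field.
Qed.

Lemma idempotent_bool (d : F) : d * (d - 1) = 0 -> exists D : bool, d = D%:R.
Proof.
move/eqP; rewrite mulf_eq0 subr_eq0.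
by case/orP=> /eqP ->; [exists false | exists true].
Qed.

(** P = r t^2 with r != 0. Write d for C1. With m0 = - (al / r) C2 the series C'
    has no t^2 term, and h0 = al^2 / r makes P' = t^2. For m1 = 0, the new B is
    al^2 / h times B0 + U t + V t^2. If d (d - 1) != 0 then B0 is nonzero, and h
    absorbs U and V. Otherwise B0 = 0 and 2d - 1 is 1 or -1, so that a suitable
    m1 removes V; a nonzero U becomes 1 for al = r U. *)
Lemma transport_to_A123 k :
  LR_relations k ->
  P0 k = 0 -> P1 k = 0 -> P2 k != 0 -> exists l, transportable (form_of l) k.
Proof.
rewrite /LR_relations /defect0 /defect1 /defect2.
case: k => b u v c d f p q r /=.
case=> D0 _ D2 p0 q0 r0; move: D0 D2; rewrite {}p0 {}q0 !mulr0 !subr0.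
move=> /eqP; rewrite expf_eq0 => /eqP ->; rewrite mul0r mul0rn add0r.
move=> /subr0_eq D2.
have bE : b = d * (d - 1) / r by apply: (canRL (mulfK r0)).
pose m0 := - f / r; pose U := u + m0 * (d *+ 2 - 1).
pose V := v + m0 * f *+ 2 + m0 ^+ 2 * r.
have [dd0|dd0] := eqVneq (d * (d - 1)) 0; last first.
  have [d0 d10] : d != 0 /\ d - 1 != 0.
    by apply/andP; rewrite -negb_or -mulf_eq0.
  exists (A1 d), 1, r^-1, (U / (d * (d - 1))), (V / (d * (d - 1))), m0, 0, 0.
  split; rewrite ?oner_neq0 ?invr_neq0 //.
  split; split=> /=; rewrite /V /U /m0 ?bE; field; rewrite ?r0 ?d0 ?d10 //.
move: bE; rewrite dd0 mul0r => bE.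
have [D dE] := idempotent_bool dd0; subst b d.
have [U0|U0] := eqVneq U 0.
  exists (A1 D%:R), 1, r^-1, 0, 0, m0, (- V * (D%:R *+ 2 - 1)), 0.
  split; rewrite ?oner_neq0 ?invr_neq0 //.
  split; split=> /=; rewrite ?dd0; try by rewrite /m0; field.
    by apply: (eq_comb (c1 := -1) (c2 := 0) (erefl 0) U0 (erefl 0));
      rewrite /U; ring.
  by rewrite /V; case: (D) => /=; ring.
have uE : u = U - m0 * (D%:R *+ 2 - 1) by rewrite addrK.
exists (if D then A3 F else A2 F), (r * U), (r * U ^+ 2), 0, 0.
exists (r * U * m0), (r * U * (- V * (D%:R *+ 2 - 1))), 0.
split; rewrite ?mulf_neq0 ?expf_neq0 //; clearbody U; subst u.
by case: (D); split; split=> /=; rewrite /V /m0; field.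
Qed.

(** P = 0, so that d = C1 satisfies d (d - 1) = 0, and 2d - 1 is 1 or -1. The
    scalar al normalises C2. If B0 != 0 then m = 0 and h = al^2 B make B' = 1;
    otherwise t divides B, and m can be chosen such that al^2 B + 2 al m C = 0,
    as 2 C is t times a unit. *)
Lemma transport_to_A4 k :
  LR_relations k ->
  P0 k = 0 -> P1 k = 0 -> P2 k = 0 ->
  exists l, transportable (form_of l) k.
Proof.
rewrite /LR_relations /defect0 /defect1 /defect2.
case: k => b u v c d f p q r /=.
case=> D0 _ D2 p0 q0 r0; move: D0 D2; rewrite p0 q0 r0 !mulr0 !subr0.
move=> /eqP; rewrite expf_eq0 => /eqP ->; rewrite mul0r mul0rn add0r.
move=> dd0; have sqr1 : (d *+ 2 - 1) * (d *+ 2 - 1) = 1.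
  by apply: (eq_comb (c1 := 4) (c2 := 0) (erefl 0) dd0 (erefl 0)); ring.
have [D dE] := idempotent_bool dd0; subst d.
pose al := if f == 0 then 1 else f.
have al0 : al != 0 by rewrite /al; case: ifPn => // _; rewrite oner_eq0.
have fE : f = al * (f != 0)%:R.
  by rewrite /al; case: eqVneq => [->|_]; rewrite (mulr0, mulr1).
move: fE; move: (f != 0) => E fE; clearbody al; subst f.
have [->|b0] := eqVneq b 0.
  pose m0 := - u * (D%:R *+ 2 - 1).
  pose m1 := - (v + m0 * (al * E%:R) *+ 2) * (D%:R *+ 2 - 1).
  exists (A4 F false D E), al, 1, 0, 0, (al * m0), (al * m1), 0.
  split; rewrite ?oner_neq0 //.
  by split; split=> /=; rewrite /m1 /m0; case: (D) => /=; ring.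
exists (A4 F true D E), al, (al ^+ 2 * b), (al ^+ 2 * u), (al ^+ 2 * v).
exists 0, 0, 0; split; rewrite ?mulf_neq0 ?expf_neq0 //.
by split; split=> /=; ring.
Qed.

Lemma transportable_listed k :
  LR_relations k ->
  exists l, transportable (form_of l) k.
Proof.
move=> kLR; have [p0|p0] := eqVneq (P0 k) 0; last first.
  by exists (A6 F); apply: transport_to_A6.
have [q0|q0] := eqVneq (P1 k) 0; last first.
  by have [a] := transport_to_A5 kLR p0 q0; exists (A5 F a).
have [r0|r0] := eqVneq (P2 k) 0; first exact: transport_to_A4.
exact: transport_to_A123.
Qed.

(** * Separating the normal forms *)

Lemma bool_natr_inj (a b : bool) (x y : F) :
  x != 0 -> y != 0 -> x * a%:R = y * b%:R -> a = b.
Proof.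
move=> x0 y0; case: a b => -[] //; rewrite mulr1 mulr0 => E.
  by rewrite E eqxx in x0.
by rewrite -E eqxx in y0.
Qed.

(** The t-adic valuation of P, capped at 3. *)
Definition val_P k : nat :=
  if P0 k != 0 then 0 else if P1 k != 0 then 1 else if P2 k != 0 then 2 else 3.

Lemma val_P_form_of l :
  val_P (form_of l) =
  match l with A6 => 0 | A5 _ => 1 | A4 _ _ _ => 3 | _ => 2 end.
Proof. by rewrite /val_P; case: l => //= *; rewrite ?eqxx ?oner_eq0. Qed.

(** P' is P times a unit, up to rescaling t. *)
Lemma transport_val_P k' k : transportable k' k -> val_P k' = val_P k.
Proof.
case=> al [h0 [h1 [h2 [m0 [m1 [m2 [al0 h00 [[E0 E1 E2] _ _]]]]]]]].
rewrite /val_P E0 mulf_eq0 (negPf h00) /=; case: eqVneq => // p0.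
rewrite p0 mulr0 addr0 in E1 E2.
have -> : (P1 k' == 0) = (P1 k == 0).
  by rewrite -(mulrI_eq0 _ (mulfI al0)) E1 mulf_eq0 (negPf h00).
case: eqVneq => // q0; rewrite q0 !mulr0 !addr0 in E2.
by rewrite -(mulrI_eq0 _ (mulfI (expf_neq0 2 al0))) E2 mulf_eq0 (negPf h00).
Qed.

(** When t^2 divides P, the term m P does not affect the coefficient of t in
    C. *)
Lemma transport_C1 k' k : transportable k' k -> (1 < val_P k)%N -> C1 k' = C1 k.
Proof.
case=> al [h0 [h1 [h2 [m0 [m1 [m2 [al0 h00 [_ [_ E1 _] _]]]]]]]].
rewrite /val_P; case: eqVneq => // p0; case: eqVneq => // q0 _.
by apply: (mulfI al0); rewrite E1 p0 q0 !mulr0 !addr0.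
Qed.

(** The invariant that distinguishes A2 from A1(0), and A3 from A1(1): there
    C2 = C2' = 0 forces m0 = 0, so that B1 is only rescaled. *)
Lemma transport_B1 k' k : transportable k' k -> val_P k = 2 ->
  B0 k' = 0 -> C0 k = 0 -> C2 k = 0 -> C2 k' = 0 ->
  (B1 k' == 0) = (B1 k == 0).
Proof.
case=> al [h0 [h1 [h2 [m0 [m1 [m2 [al0 h00 [_ [_ _ EC] [_ EB _]]]]]]]]].
rewrite /val_P; case: eqVneq => // p0; case: eqVneq => // q0.
case: eqVneq => // r0 _ b0 c0 f0 f0'; move: EC EB.
rewrite p0 q0 b0 c0 f0 f0' !(mulr0, addr0, add0r, mul0rn) => /esym/eqP.
rewrite mulf_eq0 (negPf r0) orbF => /eqP ->; rewrite mul0r mulr0 addr0 => E.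
apply/eqP/eqP => B1_0; move: E; rewrite B1_0 !mulr0.
  by move/esym/eqP; rewrite mulf_eq0 expf_eq0 (negPf al0) => /eqP.
by move/eqP; rewrite !mulf_eq0 (negPf al0) (negPf h00) => /eqP.
Qed.

Lemma transportable_A4_inj a b c a' b' c' :
  transportable (form_of (A4 F a' b' c')) (form_of (A4 F a b c)) ->
  A4 F a' b' c' = A4 F a b c.
Proof.
case=> al [h0 [h1 [h2 [m0 [m1 [m2 [al0 h00 []]]]]]]] /= _ [_ E1 E2] [E3 _ _].
rewrite !mulr0 !addr0 mul0rn addr0 in E1 E2 E3.
have al20 := expf_neq0 2 al0.
by rewrite (bool_natr_inj al0 al0 E1) (bool_natr_inj al20 al0 E2)
  (bool_natr_inj h00 al20 E3).
Qed.

Lemma transportable_A5_inj a a' :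
  transportable (form_of (A5 F a')) (form_of (A5 F a)) -> A5 F a' = A5 F a.
Proof.
case=> al [h0 [h1 [h2 [m0 [m1 [m2 [al0 h00 []]]]]]]] /= _ [_ E1 E2] [_ _ E3].
rewrite !(mulr0, mulr1, addr0, add0r) in E1 E2.
rewrite -E1 -E2 !(mulr0, mulr1, mul0r, addr0, add0r, mul0rn, expr0n) in E3.
rewrite mulrA in E3.
have al20 := expf_neq0 2 al0.
by rewrite (bool_natr_inj (mulf_neq0 h00 al20) al20 E3).
Qed.

Lemma transportable_inj l l' : transportable (form_of l') (form_of l) -> l' = l.
Proof.
move=> T; have C1E := transport_C1 T; have B1E := transport_B1 T.
have := transport_val_P T; rewrite !val_P_form_of in C1E B1E *.
case: l T C1E B1E => [a|||a b c|a|] T C1E B1E;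
  case: l' T C1E B1E => [a'|||a' b' c'|a'|] T C1E B1E //= _;
  try exact: transportable_A4_inj; try exact: transportable_A5_inj;
  have {}C1E := C1E isT; rewrite /= in C1E B1E.
- by rewrite C1E.
- by have := B1E erefl erefl erefl erefl erefl; rewrite eqxx oner_eq0.
- by have := B1E erefl erefl erefl erefl erefl; rewrite eqxx oner_eq0.
- have := B1E erefl _ erefl erefl erefl; rewrite C1E mul0r eqxx oner_eq0.
  by move/(_ erefl).
- by move/eqP: C1E; rewrite oner_eq0.
- have := B1E erefl _ erefl erefl erefl; rewrite C1E subrr mulr0 eqxx oner_eq0.
  by move/(_ erefl).
- by move/esym/eqP: C1E; rewrite oner_eq0.
Qed.

End Classification.

(** * The classification *)

Section Main.
Variable F : fieldType.

(** Every left multiplication maps the whole space into M, M into t M, and so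
    on, hence its fourth power is zero. Only the vanishing coordinates matter
    after each step, so the others are generalised. *)
Lemma form_complete (k : qform F) :
  C0 k = 0 -> P0 k = 0 -> complete (form_algebra 0 k).
Proof.
move=> c0 p0 x; exists 4; elim/vec4_ind: x => x0 x1 x2 x3.
elim/vec4_ind=> y0 y1 y2 y3 /=.
rewrite form_productE c0 p0 mul0r.
move: (B0 k * _ + _ + _) (B1 k * _ + _ - _ + _ + _ + _).
move: (_ + _ + _ * (x1 * y3 + _ + _)) => z3 z1 z2.
rewrite form_productE c0 p0 !(mulr0, mul0r, addr0, add0r).
move: (C1 k * _ + _) (_ + P1 k * (x1 * _ + _)) => w2 w3.
rewrite form_productE c0 p0 !(mulr0, mul0r, addr0, add0r, subr0, mul0rn).
move: (C1 k * _ + _) => t3.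
rewrite form_productE c0 p0 !(mulr0, mul0r, addr0, add0r, subr0, mul0rn).
by rewrite vec4_0.
Qed.

Lemma isomorphic_listed_form (l : label F) :
  isomorphic (listed l) (form_algebra 0 (form_of l)).
Proof. exact/isomorphic_eq/listed_formE. Qed.

Lemma listed_LR_structure (l : label F) : is_LR_structure (listed_product l).
Proof.
split.
  apply: is_LR_isomorphic (form_of_LR l).
  exact/isomorphic_sym/isomorphic_listed_form.
move=> x y; rewrite /commutator /= !listed_formE.
exact: (form_commutator (k := form_of l) x y).
Qed.

Lemma listed_complete (l : label F) : l <> A6 F -> complete (listed l).
Proof.
move=> lA6; have [c0 p0] : C0 (form_of l) = 0 /\ P0 (form_of l) = 0.
  by case: l lA6.
move=> x; have [n nil] := form_complete c0 p0 x; exists n => y.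
by rewrite -[RHS](nil y); apply: eq_iter => z; exact: listed_formE.
Qed.

Lemma A6_incomplete : ~ complete (listed (A6 F)).
Proof.
case/(_ (e F 2))=> n /(_ (e F 2)).
rewrite iter_fix; last exact: (@table_product_e F _ 1 1).
by rewrite !vec4E => /vec4_inj[_ /eqP]; rewrite oner_eq0.
Qed.

(** Characteristic 2 is excluded because [form_LR_a0] divides by 2. *)
Lemma LR_on_n4_listed (A : algebra F) : 2 != 0 :> F ->
  is_LR A -> isomorphic (associated_lie A) (n4 F) ->
  exists l, isomorphic A (listed l).
Proof.
move=> nz2 ALR /isomorphic_sym[g [[f gK fK] gM]].
pose fl := GRing.isLinear.Build F A 'rV[F]_4 *:%R f (can2_linear gK fK).
pose f' : {linear A -> 'rV[F]_4} := HB.pack f fl.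
pose t i j := f' (product A (g (e F i)) (g (e F j))).
have tE x y : table_product t x y = f' (product A (g x) (g y)).
  exact: (esym (@table_product_basis F A g f' x y)).
have At : isomorphic A (MkAlgebra (table_product t)).
  exists f'; split; first by exists g.
  by move=> x y; rewrite /= tE !fK.
have tLR := is_LR_isomorphic At ALR.
have [|a [k tk]] := LR_on_n4_form tLR.
  move=> x y; rewrite /= !tE -[_ - _](linearB f').
  by rewrite -[RHS]gK gM.
have tk_iso := isomorphic_eq tk.
have kLR := is_LR_isomorphic tk_iso tLR.
have a0 := form_LR_a0 nz2 kLR; subst a.
have [l lk] :=
  transportable_listed (proj1 (form_LRP k) kLR).
exists l; apply: (isomorphic_trans At); apply: (isomorphic_trans tk_iso).
apply/isomorphic_sym/(isomorphic_trans (isomorphic_listed_form l)).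
exact: transport_isomorphic lk.
Qed.

Lemma isomorphic_listed_inj (l l' : label F) :
  isomorphic (listed l) (listed l') -> l = l'.
Proof.
move=> ll'; apply/transportable_inj/isomorphic_transport.
apply/(isomorphic_trans (isomorphic_sym (isomorphic_listed_form l))).
exact: isomorphic_trans ll' (isomorphic_listed_form l').
Qed.

End Main.

Theorem proposition3p2 (R : realType) :
  (forall l : label R, is_LR_structure (listed_product l)) /\
  (forall A : algebra R,
     is_LR A -> isomorphic (associated_lie A) (n4 R) ->
     exists! l : label R, isomorphic A (listed l)) /\
  ~ complete (listed (A6 R)) /\
  (forall l : label R, l <> A6 R -> complete (listed l)).
Proof.
split; first exact: listed_LR_structure.
split; last by split; [exact: A6_incomplete | exact: listed_complete].
move=> A ALR An4; have nz2 : 2 != 0 :> R by rewrite Num.Theory.pnatr_eq0.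
have [l Al] := LR_on_n4_listed nz2 ALR An4; exists l; split=> // l' Al'.
exact/isomorphic_listed_inj/(isomorphic_trans (isomorphic_sym Al)).
Qed.
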